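(* Let $K$ be a field, $R=K[x_1,\dots,x_n]$, and let $J\subset R$ be an almost square-free Veronese type ideal of degree $d\ge 2$ which is full-supported and satisfies $\gcd(J)=1$. Then $$\operatorname{astab}(J)=\operatorname{dstab}(J)=\left\lceil \frac{n-1}{n-d}\right\rceil .$$
   Context: For a monomial ideal $J$ of $R=K[x_1,\dots,x_n]$, $G(J)$ denotes its unique minimal set of monomial generators. $J$ is full-supported if every variable $x_1,\dots,x_n$ divides some element of $G(J)$; $\gcd(J)$ is the greatest common divisor of the elements of $G(J)$. $I_{d;n}$ denotes the ideal of $R$ generated by all square-free monomials of degree $d$ in $x_1,\dots,x_n$ (the square-free Veronese ideal). A monomial ideal $J$ is an almost square-free Veronese (type) ideal of degree $d$ if $J\ne 0$, $G(J)\subseteq G(I_{d;n})$ and $|G(J)|\ge |G(I_{d;n})|-1$. $\operatorname{Ass}(J)$ denotes the set of associated primes of $R/J$. By Brodmann, $\operatorname{Ass}(J^t)$ and $\operatorname{depth} R/J^t$ are constant for large $t$. $\operatorname{astab}(J)$ is the smallest integer $t_0\ge 1$ with $\operatorname{Ass}(J^t)=\operatorname{Ass}(J^{t_0})$ for all $t\ge t_0$, and $\operatorname{dstab}(J)$ is the smallest integer $t_0\ge 1$ with $\operatorname{depth} R/J^t=\operatorname{depth} R/J^{t_0}$ for all $t\ge t_0$. *)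

(* Defs.v *)
From mathcomp Require Import all_boot all_order all_algebra.
From mathcomp Require Import finmap boolp classical_sets.
From mathcomp Require Import mpoly.

Set Implicit Arguments.
Unset Strict Implicit.
Unset Printing Implicit Defensive.

Local Open Scope ring_scope.
Local Open Scope classical_set_scope.

Section Ideals.
Context {R : comNzRingType}.
Implicit Types (A I J P : set R) (s : seq R) (t r : nat).

Definition ideal_gen A : set R :=
  [set p | exists2 s : seq (R * R),
     (forall x, x \in s -> A x.2) & p = \sum_(x <- s) x.1 * x.2].

Definition is_ideal I : Prop :=
  [/\ I 0, (forall x y, I x -> I y -> I (x + y)) &
      (forall a x, I x -> I (a * x))].

Definition prime_ideal P : Prop :=
  [/\ is_ideal P, ~ P 1 & (forall x y, P (x * y) -> P x \/ P y)].

(* [ideal_pow J 0] is the unit ideal, the empty product being 1. *)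
Definition ideal_pow J t : set R :=
  ideal_gen [set \prod_(i < t) f i | f in [set f : 'I_t -> R | forall i, J (f i)]].

(* [set p | I (p * f)] is the annihilator of the class of f in R/I. *)
Definition Ass I : set (set R) :=
  [set P | prime_ideal P /\ exists f, P = [set p | I (p * f)]].

(* (R/I)-regular sequences: each s_k is a nonzerodivisor on
   R/(I, s_0, ..., s_(k-1)), and R/(I, s) is nonzero. *)
Definition regular_seq I s : Prop :=
  (forall k, (k < size s)%N -> forall g,
     ideal_gen (I `|` [set` take k s]) (g * s`_k) ->
     ideal_gen (I `|` [set` take k s]) g)
  /\ ideal_gen (I `|` [set` s]) <> setT.

End Ideals.

(* The least (resp. greatest) element of a set of natural numbers; the default
   value 0 is taken only if there is none. *)
Definition least (A : set nat) : nat :=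
  xget 0%N [set t | A t /\ forall u, A u -> (t <= u)%N].

Definition greatest (A : set nat) : nat :=
  xget 0%N [set t | A t /\ forall u, A u -> (u <= t)%N].

Section Polynomials.
Context {K : fieldType} {n : nat}.
Implicit Types (J : set {mpoly K[n]}) (G : {fset 'X_{1..n}}) (d : nat).

Definition irrelevant_ideal : set {mpoly K[n]} :=
  ideal_gen [set 'X_i | i in [set: 'I_n]].

(* depth of the graded ring R/J, that is, with respect to the graded maximal
   ideal (x_1, ..., x_n). *)
Definition depth_quot J : nat :=
  greatest [set r | exists s : seq {mpoly K[n]},
    [/\ size s = r, (forall f, f \in s -> irrelevant_ideal f) &
        regular_seq J s]].

Definition astab J : nat :=
  least [set t0 | (0 < t0)%N /\
    forall t, (t0 <= t)%N -> Ass (ideal_pow J t) = Ass (ideal_pow J t0)].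

Definition dstab J : nat :=
  least [set t0 | (0 < t0)%N /\
    forall t, (t0 <= t)%N ->
      depth_quot (ideal_pow J t) = depth_quot (ideal_pow J t0)].

Definition monomials_ideal (M : set 'X_{1..n}) : set {mpoly K[n]} :=
  ideal_gen [set 'X_[m] | m in M].

Definition monomial_ideal J : Prop := exists M, J = monomials_ideal M.

(* Monomials are represented by their exponents. *)
Definition is_min_gens J G : Prop :=
  J = monomials_ideal [set` G] /\
  forall G', {subset G' <= G} -> J = monomials_ideal [set` G'] -> G' = G.

(* G(J): for a monomial ideal J there is exactly one G with [is_min_gens J G],
   and it is finite; the default value fset0 is then never used. *)
Definition min_gens J : {fset 'X_{1..n}} := xget fset0 (is_min_gens J).

Definition sqfree_mon (m : 'X_{1..n}) : Prop := forall i, (m i <= 1)%N.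

Definition sqfree_veronese d : set {mpoly K[n]} :=
  monomials_ideal [set m | sqfree_mon m /\ mdeg m = d].

(* The last inequality is |G(J)| >= |G(I_{d;n})| - 1. *)
Definition almost_sqfree_veronese d J : Prop :=
  [/\ monomial_ideal J,
      J <> [set 0],
      {subset min_gens J <= min_gens (sqfree_veronese d)} &
      (#|` min_gens (sqfree_veronese d)| <= #|` min_gens J|.+1)%N].

Definition full_supported J : Prop :=
  forall i : 'I_n, exists2 m, m \in min_gens J & (0 < m i)%N.

(* [(m <= m')%MM] is divisibility of monomials. *)
Definition is_mon_gcd G (g : 'X_{1..n}) : Prop :=
  (forall m, m \in G -> (g <= m)%MM) /\
  forall h, (forall m, m \in G -> (h <= m)%MM) -> (h <= g)%MM.

Definition has_gcd1 J : Prop := is_mon_gcd (min_gens J) 0%MM.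

End Polynomials.

(* Main.v *)
(* A monomial x^u lies in J^t iff sum_i min(u_i, t) >= t d and, when the generator
   x_A is missing, also sum_(i notin A) min(u_i, t) >= t. This reduces everything
   to truncated exponents: the associated primes of J^t are the ideals P_S of the
   variables in S for which some monomial outside J^t, with exponents >= t off S,
   is moved into J^t by every variable of S. A count of exponents shows that for
   t (n - d) >= n - 1 the set of such S no longer depends on t and contains the
   full set, while for t (n - d) < n - 1 the full set is excluded. The depth of
   R/J^t is 0 iff the full set occurs, since otherwise x_1 + ... + x_n is a
   nonzerodivisor modulo J^t. *)
Require Import Defs.
From mathcomp Require Import all_boot all_order all_algebra.
From mathcomp Require Import finmap boolp classical_sets.
From mathcomp Require Import mpoly.
From mathcomp Require Import zify.

Set Implicit Arguments.
Unset Strict Implicit.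
Unset Printing Implicit Defensive.

Import GRing.Theory.

Local Open Scope ring_scope.
Local Open Scope classical_set_scope.

(** * Ideals spanned by monomials *)

Section Ideals.
Context {R : comNzRingType}.
Implicit Types (A I P : set R) (s : seq R).

(** The threshold comes from the full set: its witness has all exponents at most t - 1 and total t d
    - 1, and the capacity n (t - 1) reaches this total exactly when n - 1 <= t (n - d). The
    condition on the gcd gives d < n and, when x_A is missing, d + 1 < n; then at least two
    variables lie off A, and for t >= 2 exponents at most t - 1 on them can still add up to t. The
    delicate point is positive depth. Depth is the greatest length of a regular sequence, with
    default 0 if there is none, so exhibiting one regular element is not enough: the lengths must be
    bounded. The bound comes from linear algebra: products of powers below N of r elements of a
    regular sequence are N^r polynomials, linearly independent modulo the ideal and of degree O(N),
    while polynomials of degree O(N) in n variables form a space of dimension O(N^n); hence r <= n.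
    Regularity of x_1 + ... + x_n is proved on supports of polynomials, hence over every field,
    finite ones included. *)

Lemma ideal_sum I (T : eqType) (r : seq T) (F : T -> R) :
  is_ideal I -> (forall x, x \in r -> I (F x)) -> I (\sum_(x <- r) F x).
Proof.
case=> I0 ID _ IF; rewrite big_seq.
by elim/big_ind: _.
Qed.

Lemma idealN I x : is_ideal I -> I x -> I (- x).
Proof. by case=> _ _ IM Ix; rewrite -mulN1r; exact: IM. Qed.

Lemma sub_ideal_gen A : A `<=` ideal_gen A.
Proof.
move=> x Ax; exists [:: (1, x)]; last by rewrite big_seq1 mul1r.
by move=> y; rewrite inE => /eqP ->.
Qed.

Lemma ideal_gen_ideal A : is_ideal (ideal_gen A).
Proof.
split.
- by exists [::] => //; rewrite big_nil.
- move=> x y [s sA ->] [t tA ->]; exists (s ++ t); last by rewrite big_cat.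
  by move=> z; rewrite mem_cat => /orP[/sA|/tA].
- move=> a x [s sA ->]; exists [seq (a * z.1, z.2) | z <- s].
    by move=> z /mapP[w /sA ? ->].
  by rewrite big_map mulr_sumr; apply: eq_bigr => z _; rewrite mulrA.
Qed.

Lemma ideal_genM A a x : ideal_gen A x -> ideal_gen A (a * x).
Proof. by have [_ _] := ideal_gen_ideal A; apply. Qed.

Lemma ideal_gen_min A I : is_ideal I -> A `<=` I -> ideal_gen A `<=` I.
Proof.
move=> II AI x [s sA ->]; apply: ideal_sum => // z /sA /AI.
by case: II => _ _; apply.
Qed.

Lemma ideal_gen_id I : is_ideal I -> ideal_gen I = I.
Proof.
by move=> II; apply/seteqP; split; [exact: ideal_gen_min | exact: sub_ideal_gen].
Qed.

Lemma ideal_genS A B : A `<=` B -> ideal_gen A `<=` ideal_gen B.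
Proof.
move=> AB; apply: ideal_gen_min; first exact: ideal_gen_ideal.
by move=> x /AB /sub_ideal_gen.
Qed.

Lemma colon_ideal I g : is_ideal I -> is_ideal [set p | I (p * g)].
Proof.
case=> I0 ID IM; split => /=.
- by rewrite mul0r.
- by move=> x y Ix Iy; rewrite mulrDl; exact: ID.
- by move=> a x Ix; rewrite -mulrA; exact: IM.
Qed.

End Ideals.

Section MonomialSpans.
Context {K : fieldType} {n : nat}.
Implicit Types (M : set 'X_{1..n}) (p f g : {mpoly K[n]}) (u v w : 'X_{1..n}).
Implicit Types (S : {set 'I_n}) (N : nat).

Definition upclosed M := forall u v, M u -> M (u + v)%MM.

(** For upward closed [M] this is the ideal spanned by the monomials of [M]; membership is read off
    the support, so that questions on ideals become questions on exponents. *)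
Definition span_mon M : set {mpoly K[n]} :=
  [set p | forall u, u \in msupp p -> M u].

Lemma upclosed_le M u v : upclosed M -> (u <= v)%MM -> M u -> M v.
Proof. by move=> upM /submK <- Mu; rewrite addmC; exact: upM. Qed.

Lemma span_mon_ideal M : upclosed M -> is_ideal (span_mon M).
Proof.
move=> upM; split.
- by move=> u; rewrite msupp0.
- by move=> p q Mp Mq u /msuppD_le; rewrite mem_cat => /orP[/Mp|/Mq].
- move=> a p Mp u /msuppM_le /allpairsP[[v w] /= [_ wp ->]].
  by rewrite addmC; apply: upM; exact: Mp.
Qed.

Lemma span_monX M u : span_mon M 'X_[u] <-> M u.
Proof.
split; first by apply; rewrite msuppX inE.
by move=> Mu v; rewrite msuppX inE => /eqP ->.
Qed.

Lemma mem_msuppMX p u v : (v \in msupp (p * 'X_[u])) =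
  (u <= v)%MM && ((v - u)%MM \in msupp p).
Proof.
rewrite (perm_mem (msuppMX p u)); apply/mapP/andP => [[w wp ->]|[uv vp]].
  by rewrite lem_addr addmC addmK.
by exists (v - u)%MM => //; rewrite addmC submK.
Qed.

Lemma span_monMX M p u :
  span_mon M (p * 'X_[u]) <-> forall v, v \in msupp p -> M (v + u)%MM.
Proof.
split=> [Mp v vp|Mp v].
  by apply: Mp; rewrite mem_msuppMX addmK vp lem_addl.
by rewrite mem_msuppMX => /andP[uv /Mp]; rewrite submK.
Qed.

Lemma monomials_idealE M :
  monomials_ideal M = span_mon [set u | exists2 m, M m & (m <= u)%MM].
Proof.
have upM : upclosed [set u | exists2 m, M m & (m <= u)%MM].
  by move=> u v [m Mm mu]; exists m => //; exact: lepm_trans mu (lem_addr _ _).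
apply/seteqP; split.
  apply: ideal_gen_min; first exact: span_mon_ideal.
  by move=> _ [m Mm <-]; apply/span_monX; exists m => //; exact: lepm_refl.
move=> p Mp; rewrite (mpolyE p).
apply: ideal_sum; first exact: ideal_gen_ideal.
move=> u /Mp [m Mm mu]; rewrite -(submK mu) mpolyXD -mul_mpolyC mulrA.
by apply/ideal_genM/sub_ideal_gen; exists m.
Qed.

Fixpoint mon_pow (G : set 'X_{1..n}) (t : nat) : set 'X_{1..n} :=
  if t is t'.+1 then
    [set u | exists2 b, G b & (b <= u)%MM /\ mon_pow G t' (u - b)%MM]
  else [set: 'X_{1..n}].

Lemma mon_pow_up G t : upclosed (mon_pow G t).
Proof.
elim: t => [//|t IH] u v /= [b Gb [bu Mu]]; exists b => //; split.
  exact: lepm_trans bu (lem_addr _ _).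
by rewrite addmC -addmBA // addmC; exact: IH.
Qed.

Lemma ideal_pow_monomials G t :
  ideal_pow (monomials_ideal G) t = span_mon (mon_pow G t).
Proof.
apply/seteqP; split.
  apply: ideal_gen_min; first exact/span_mon_ideal/mon_pow_up.
  move=> _ [f /= Jf <-]; elim: t f Jf => [//|t IH] f Jf.
  rewrite big_ord_recl => w /msuppM_le /allpairsP[[u v] /= [uf vf ->]].
  have := Jf ord0; rewrite monomials_idealE => /(_ _ uf)[b Gb bu].
  exists b => //; split; first exact: lepm_trans bu (lem_addr _ _).
  rewrite addmC -addmBA // addmC addmC; apply: mon_pow_up.
  exact: (IH (fun i => f (lift ord0 i))).
(* The family [f] is indexed by all naturals, with no condition from [t] on, so that the induction
   can shift indices freely. *)
have prodX u : mon_pow G t u -> exists (f : nat -> {mpoly K[n]}) (v : 'X_{1..n}),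
    (forall i, monomials_ideal G (f i) \/ (t <= i)%N) /\
    'X_[u] = 'X_[v] * \prod_(i < t) f i.
  elim: t u => [|t IH] u /=.
    move=> _; exists (fun=> 0), u; split; first by move=> i; right.
    by rewrite big_ord0 mulr1.
  case=> b Gb [bu /IH[f [v [Jf uE]]]].
  exists (fun i => if i is i'.+1 then f i' else 'X_[b]), v; split.
    case=> [|i]; last by case: (Jf i) => ?; [left | right].
    by left; apply: sub_ideal_gen; exists b.
  rewrite big_ord_recl /= -(submK bu) mpolyXD uE -mulrA; congr (_ * _).
  by rewrite mulrC.
move=> p Mp; rewrite (mpolyE p); apply: ideal_sum; first exact: ideal_gen_ideal.
move=> u /Mp /prodX [f [v [Jf ->]]]; rewrite -mul_mpolyC mulrA.
apply/ideal_genM/sub_ideal_gen; exists (fun i : 'I_t => f i) => //= i.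
by case: (Jf i) => //; rewrite leqNgt ltn_ord.
Qed.

End MonomialSpans.

(** * Associated primes of monomial ideals *)

Section AssociatedPrimes.
Context {K : fieldType} {n : nat}.
Implicit Types (M : set 'X_{1..n}) (p f g : {mpoly K[n]}) (u v w : 'X_{1..n}).
Implicit Types (S : {set 'I_n}) (N : nat).

Definition mon_part (Q : pred 'X_{1..n}) p : {mpoly K[n]} :=
  \sum_(m <- msupp p | Q m) p@_m *: 'X_[m].

Lemma mcoeff_mon_part Q p u : (mon_part Q p)@_u = if Q u then p@_u else 0.
Proof.
rewrite raddf_sum big_mkcond /=.
have [up|] := boolP (u \in msupp p); last first.
  move=> uNp; rewrite (memN_msupp_eq0 uNp) if_same big_seq big1 // => m mp.
  rewrite mcoeffZ mcoeffX; case: eqP => [mu|]; last by rewrite mulr0 if_same.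
  by rewrite -mu mp in uNp.
rewrite (bigD1_seq u) ?msupp_uniq //= mcoeffZ mcoeffX eqxx mulr1.
rewrite big1 ?addr0 // => m /negbTE mu.
by rewrite mcoeffZ mcoeffX mu mulr0 if_same.
Qed.

Lemma mem_msupp_mon_part Q p u : (u \in msupp (mon_part Q p)) = Q u && (u \in msupp p).
Proof. by rewrite !mcoeff_msupp mcoeff_mon_part; case: (Q u); rewrite ?eqxx. Qed.

Lemma mon_partC Q p : p = mon_part Q p + mon_part (predC Q) p.
Proof.
apply/mpolyP => u; rewrite mcoeffD !mcoeff_mon_part /=.
by case: (Q u); rewrite ?addr0 ?add0r.
Qed.

Lemma mon_part_neq0 (Q : pred 'X_{1..n}) p u : u \in msupp p -> Q u -> mon_part Q p != 0.
Proof.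
move=> up Qu; apply/eqP => p0.
by have := mem_msupp_mon_part Q p u; rewrite p0 msupp0 up Qu.
Qed.

Lemma neq0_msupp p : p != 0 -> exists u, u \in msupp p.
Proof. by move=> /mlead_supp; exists (mlead p). Qed.

Lemma prime_monX (P : set {mpoly K[n]}) u :
  prime_ideal P -> P 'X_[u] -> exists2 i, (0 < u i)%N & P 'X_i.
Proof.
case=> _ P1 PM; elim: {u}(mdeg u) {-2}u (erefl (mdeg u)) => [|k IH] u.
  by move/eqP; rewrite mdeg_eq0 => /eqP ->; rewrite mpolyX0.
move=> uk; have /existsP[i ui] : [exists i, (0 < u i)%N].
  apply: contraT; rewrite negb_exists => /forallP u0.
  suff /eqP : mdeg u == 0%N by rewrite uk.
  by rewrite mdegE sum_nat_eq0; apply/forallP => i; rewrite eqn0Ngt u0.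
have Uu : (U_(i) <= u)%MM by rewrite lep1mP -lt0n.
have uE := submK Uu; rewrite -{1}uE mpolyXD => /PM [|Pi]; last by exists i.
case/IH => [|j]; last by rewrite mnmBE => uj Pj; exists j => //; lia.
by have := mdegD (u - U_(i))%MM U_(i); rewrite uE uk mdeg1; lia.
Qed.

Definition var_prime S : set {mpoly K[n]} :=
  span_mon [set u | exists2 i, i \in S & (0 < u i)%N].

Lemma var_prime_up S : upclosed [set u : 'X_{1..n} | exists2 i, i \in S & (0 < u i)%N].
Proof. by move=> u v [i iS ui]; exists i => //; rewrite mnmDE; lia. Qed.

Lemma var_prime_ideal S : is_ideal (var_prime S).
Proof. exact/span_mon_ideal/var_prime_up. Qed.

Lemma var_primeX S i : var_prime S 'X_i <-> i \in S.
Proof.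
rewrite /var_prime; split; last first.
  by move=> iS; apply/span_monX; exists i => //; rewrite mnm1E eqxx.
move/span_monX => [j jS]; rewrite mnm1E; by case: eqP => // ->.
Qed.

Lemma var_prime_inj S T : var_prime S = var_prime T -> S = T.
Proof.
move=> ST; apply/setP => i; apply/idP/idP => /var_primeX.
  by rewrite ST => /var_primeX.
by rewrite -ST => /var_primeX.
Qed.

Definition off_vars S : pred 'X_{1..n} := [pred u : 'X_{1..n} | [forall i in S, u i == 0%N]].

Lemma off_varsPn S u : reflect (exists2 i, i \in S & (0 < u i)%N) (~~ off_vars S u).
Proof.
rewrite /off_vars /= negb_forall_in.
by apply: (iffP exists_inP) => -[i iS ui]; exists i => //; rewrite ?lt0n // -lt0n.
Qed.

Lemma var_prime_mon_part S p : var_prime S (mon_part (predC (off_vars S)) p).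
Proof. by move=> u; rewrite mem_msupp_mon_part => /andP[/off_varsPn]. Qed.

Lemma not_var_prime_part S p : ~ var_prime S p -> mon_part (off_vars S) p != 0.
Proof.
move=> NP; apply/eqP => p0; apply: NP.
by rewrite (mon_partC (off_vars S) p) p0 add0r; exact: var_prime_mon_part.
Qed.

Lemma off_varsD S u v : off_vars S u -> off_vars S v -> off_vars S (u + v)%MM.
Proof.
move=> /forall_inP Su /forall_inP Sv; apply/forall_inP => i iS.
by rewrite mnmDE (eqP (Su i iS)) (eqP (Sv i iS)).
Qed.

(** Modulo the variables of [S] a polynomial equals its part free of them, and a product of two
    nonzero polynomials free of these variables is again nonzero and free of them. *)
Lemma var_prime_prime S : prime_ideal (var_prime S).
Proof.
have II := var_prime_ideal S.
split=> //.
  rewrite -mpolyX0 => /span_monX [i _]; by rewrite mnm0E.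
move=> p q pq; apply: contrapT => /not_orP[/not_var_prime_part p0 /not_var_prime_part q0].
have [_ ID IM] := II.
set p' := mon_part _ p in p0; set q' := mon_part _ q in q0.
have : var_prime S (p' * q').
  have -> : p' * q' = p * q + - (p * mon_part (predC (off_vars S)) q
      + q' * mon_part (predC (off_vars S)) p).
    rewrite {1}(mon_partC (off_vars S) q) -/q' mulrDr opprD addrA addrK.
    rewrite [p * q']mulrC -mulrBr {1}(mon_partC (off_vars S) p) -/p'.
    by rewrite addrK mulrC.
  by apply: (ID) => //; apply: (idealN II); apply: ID; apply: IM; exact: var_prime_mon_part.
have /neq0_msupp[u upq] : p' * q' != 0 by rewrite mulf_neq0.
move=> /(_ _ upq)/off_varsPn/negP; apply.
have /allpairsP[[v w] /= [+ + ->]] := msuppM_le upq.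
by rewrite !mem_msupp_mon_part => /andP[Sv _] /andP[Sw _]; exact: off_varsD.
Qed.

(** Raising an exponent beyond [N] is invisible to [M], so exponents at least [N] off [S] play the
    role of inverting the variables off [S]. *)
Definition truncated N M :=
  forall u v, (forall i, minn (u i) N = minn (v i) N) -> M u -> M v.

(* For M upward closed and truncated at N, these are the S such that the ideal
   of the variables in S is the annihilator of a monomial modulo M. *)
Definition mon_assoc N M S := exists u, [/\ ~ M u,
  forall i, i \notin S -> (N <= u i)%N & forall i, i \in S -> M (u + U_(i))%MM].

(** A prime P that annihilates f contains no power of a variable outside it. Hence f times the
    [N]-th powers of these variables still has a monomial outside [M], and the annihilator of that
    single monomial is already P. *)
Lemma Ass_span_mon N M : upclosed M -> truncated N M ->
  Ass (span_mon M) = [set P | exists2 S, mon_assoc N M S & P = var_prime S].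
Proof.
move=> upM trM; have II := @span_mon_ideal K n M upM.
have off_saturated S u v : (forall i, i \notin S -> N <= u i)%N ->
    off_vars S v -> M (v + u)%MM -> M u.
  move=> uN /forall_inP Sv; apply: trM => i; rewrite mnmDE.
  by have [/Sv/eqP ->//|/uN] := boolP (i \in S); lia.
apply/seteqP; split; last first.
  move=> _ [S [u [NMu uN MuS]] ->]; split; first exact: var_prime_prime.
  exists 'X_[u]; apply/seteqP; split=> [p Sp|p Mp].
    apply/span_monMX => v /Sp [i iS vi].
    have Uv : (U_(i) <= v)%MM by rewrite lep1mP -lt0n.
    by rewrite -(submK Uv) -addmA addmC [(U_(_) + _)%MM]addmC; apply: upM; exact: MuS.
  move=> v vp; apply/off_varsPn/negP => Sv; apply: NMu.
  by apply: (off_saturated S u v) => //; move/span_monMX : Mp; exact.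
move=> P [Pprime [f Pf]]; have [PI _ Pmul] := Pprime; have [_ PD PM] := PI.
pose S : {set 'I_n} := [set i | `[< P 'X_i >]]%SET.
have SP i : (i \in S) <-> P 'X_i by rewrite inE; split=> /asboolP.
pose w := [multinom if i \in S then 0%N else N | i < n].
pose bad := [pred u : 'X_{1..n} | ~~ `[< M (u + w)%MM >]].
have wN u i : i \notin S -> (N <= (u + w)%MM i)%N.
  by move=> /negbTE iS; rewrite mnmDE mnmE iS leq_addl.
have NPw : ~ P 'X_[w].
  by case/(prime_monX Pprime) => i + /SP iS; rewrite mnmE iS.
have [u0 u0f bad0] : exists2 u, u \in msupp f & bad u.
  apply: contrapT => Nbad; apply: NPw; rewrite Pf /= mulrC.
  apply/span_monMX => u uf; apply: contrapT => NM; apply: Nbad; exists u => //=.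
  exact/asboolPn.
have SubP : var_prime S `<=` P.
  move=> p Sp; rewrite (mpolyE p); apply: ideal_sum => //.
  move=> u /Sp [i iS ui]; have Uu : (U_(i) <= u)%MM by rewrite lep1mP -lt0n.
  by rewrite -(submK Uu) mpolyXD -mul_mpolyC mulrA; apply: PM; exact/SP.
exists S.
  exists (u0 + w)%MM; split; first exact/asboolPn.
    exact: wN.
  move=> i /SP; rewrite Pf /= mulrC => /span_monMX /(_ _ u0f) /upM - /(_ w).
  by rewrite -[in X in _ -> X]addmA [(w + _)%MM]addmC addmA.
(* An element of P outside P_S can be replaced by its part [g0] free of the variables of [S]. Then
   [g0] times the bad part of [f] times x^w lies in the ideal; but each of its monomials is a bad
   one moved only in directions where the exponent has already reached [N], hence lies outside
   [M]. *)
apply/seteqP; split=> // g Pg; apply: contrapT => /not_var_prime_part.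
set g0 := mon_part _ g => g0_neq0.
have Pg0 : P g0.
  have -> : g0 = g - mon_part (predC (off_vars S)) g.
    by rewrite {1}(mon_partC (off_vars S) g) addrK.
  by apply: (PD) => //; apply: (idealN PI); apply: SubP; exact: var_prime_mon_part.
have : span_mon M (g0 * mon_part bad f * 'X_[w]).
  have [_ ID IM] := II.
  have -> : g0 * mon_part bad f * 'X_[w] =
      g0 * f * 'X_[w] + - (g0 * (mon_part (predC bad) f * 'X_[w])).
    by rewrite {2}(mon_partC bad f) mulrDr mulrDl -!mulrA addrK.
  apply: (ID); first by rewrite mulrC; apply: IM; rewrite Pf in Pg0.
  apply: (idealN II); apply: IM; apply/span_monMX => u.
  by rewrite mem_msupp_mon_part /= negbK => /andP[/asboolP].
have := mulf_neq0 g0_neq0 (mon_part_neq0 u0f bad0).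
move=> /neq0_msupp[z zg] /span_monMX/(_ _ zg).
have /allpairsP[[v u] /= [+ + ->]] := msuppM_le zg.
rewrite !mem_msupp_mon_part => /andP[Sv _] /andP[/asboolPn NMu _].
by rewrite -addmA => /off_saturated Mu; apply: NMu; apply: (Mu S) => // i; exact: wN.
Qed.

End AssociatedPrimes.

(** * Regular sequences and depth *)

Lemma regular_seq_cons {R : comNzRingType} (I : set R) x s :
  is_ideal I -> regular_seq I (x :: s) ->
  (forall g, I (g * x) -> I g) /\
  regular_seq (ideal_gen (I `|` [set` [:: x]])) s.
Proof.
move=> II [reg nT].
have I_x t : ideal_gen (ideal_gen (I `|` [set` [:: x]]) `|` [set` t]) =
             ideal_gen (I `|` [set` (x :: t)]).
  apply/seteqP; split; apply: ideal_gen_min; try exact: ideal_gen_ideal.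
    move=> y [|ty]; last by apply: sub_ideal_gen; right; rewrite /= inE ty orbT.
    apply: ideal_genS => z [Iz|zx]; first by left.
    by right; move: zx; rewrite /= !inE => ->.
  move=> y [Iy|]; first by do 2![apply: sub_ideal_gen; left].
  rewrite /= inE => /orP[yx|ty]; last by apply: sub_ideal_gen; right.
  by apply: sub_ideal_gen; left; apply: sub_ideal_gen; right; rewrite /= inE.
have I0 : ideal_gen (I `|` [set` [::]]) = I.
  rewrite -[RHS](ideal_gen_id II); congr ideal_gen.
  by apply/seteqP; split=> y; [case | left].
split; first by move=> g; have := reg 0%N isT g; rewrite /= I0.
split; last by rewrite I_x.
by move=> k ks g; rewrite I_x; have := reg k.+1 ks g.
Qed.

Section RegularSequenceLength.
Context {K : fieldType} {n : nat}.
Implicit Types (p f g x : {mpoly K[n]}) (s : seq {mpoly K[n]}).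
Implicit Types (I : set {mpoly K[n]}) (c : nat -> K) (e N : nat).

(* The linear combination, with coefficients c, of the monomials in s with
   exponents < N, the exponents being the N-adic digits of the index. *)
Fixpoint digit_comb N s c : {mpoly K[n]} :=
  if s is x :: s' then
    \sum_(k < N) x ^+ k * digit_comb N s' (fun j => c (k + N * j)%N)
  else (c 0%N)%:MP.

Lemma digit_comb0 N s c :
  (forall j, (j < N ^ size s)%N -> c j = 0) -> digit_comb N s c = 0.
Proof.
elim: s c => [|x s IH] c c0 /=; first by rewrite c0 ?mpolyC0.
rewrite big1 // => k _; rewrite IH ?mulr0 // => j jN; apply: c0.
rewrite /= expnS; have := ltn_ord k; nia.
Qed.

Lemma digit_comb_sum N s m (a : 'I_m -> K) (c : 'I_m -> nat -> K) :
  digit_comb N s (fun j => \sum_i a i * c i j) = \sum_i a i *: digit_comb N s (c i).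
Proof.
elim: s c => [|x s IH] c /=.
  by rewrite raddf_sum; apply: eq_bigr => i _; rewrite /= mpolyCM mul_mpolyC.
under [RHS]eq_bigr do rewrite scaler_sumr.
rewrite exchange_big; apply: eq_bigr => k _ /=.
rewrite IH mulr_sumr; apply: eq_bigr => i _.
by rewrite scalerAr.
Qed.

(** Modulo (I, x) only [g 0] remains, so it vanishes; the rest of the sum is a multiple of [x],
    which cancels by regularity, and the same argument applies to the shifted family. *)
Lemma power_sum_in_ideal I x N (g : nat -> {mpoly K[n]}) :
  is_ideal I -> (forall h, I (h * x) -> I h) ->
  (forall k, (k < N)%N -> ideal_gen (I `|` [set` [:: x]]) (g k) -> g k = 0) ->
  I (\sum_(k < N) x ^+ k * g k) -> forall k, (k < N)%N -> g k = 0.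
Proof.
move=> II regx; elim: N g => [|N IH] g g0 //.
rewrite big_ord_recl expr0 mul1r => Isum.
have sumE : \sum_(k < N) x ^+ (lift ord0 k) * g (lift ord0 k) =
    (\sum_(k < N) x ^+ k * g k.+1) * x.
  rewrite mulr_suml; apply: eq_bigr => k _.
  by rewrite lift0 exprS -mulrA mulrC.
have g00 : g 0%N = 0.
  apply: g0 => //; have [_ GD GM] := ideal_gen_ideal (I `|` [set` [:: x]]).
  rewrite -[g 0%N](addrK (\sum_(k < N) x ^+ (lift ord0 k) * g (lift ord0 k))).
  apply: GD; first by apply: sub_ideal_gen; left.
  rewrite sumE -mulNr; apply: GM; apply: sub_ideal_gen.
  by right; rewrite /= inE.
have {}IH := IH (fun k => g k.+1); case=> [//|k] kN; apply: IH => //.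
  by move=> j jN; exact: g0.
by apply: regx; rewrite -sumE; rewrite g00 add0r in Isum.
Qed.

(** The lowest digit is the exponent of the head [x]. By induction, modulo (I, x), a coefficient
    polynomial of a power of [x] can lie in (I, x) only if all its own coefficients vanish, which is
    the hypothesis of [power_sum_in_ideal]. *)
Lemma digit_comb_indep N s I c : is_ideal I -> regular_seq I s ->
  I (digit_comb N s c) -> forall j, (j < N ^ size s)%N -> c j = 0.
Proof.
elim: s I c => [|x s IH] I c II reg.
  case: reg => _ nT /= Ic j; rewrite expn0 ltnS leqn0 => /eqP ->.
  apply: contrapT => /eqP c0; apply: nT; apply/seteqP; split=> // p _.
  apply: sub_ideal_gen; left; have [_ _ IM] := II.
  have -> : p = (p * (c 0%N)^-1%:MP) * (c 0%N)%:MP; last exact: IM.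
  by rewrite -mulrA -mpolyCM mulVf // mpolyC1 mulr1.
have [regx regs] := regular_seq_cons II reg.
move=> /= Ic j jN; rewrite /= expnS in jN.
have N0 : (0 < N)%N by lia.
have {}IH k : ideal_gen (I `|` [set` [:: x]])
      (digit_comb N s (fun j => c (k + N * j)%N)) ->
    forall j, (j < N ^ size s)%N -> c (k + N * j)%N = 0.
  by apply: IH => //; exact: ideal_gen_ideal.
pose g k := digit_comb N s (fun j => c (k + N * j)%N).
have g0 : forall k, (k < N)%N -> g k = 0.
  exact: power_sum_in_ideal II regx (fun k _ Ik => digit_comb0 (IH k Ik)) Ic.
rewrite (divn_eq j N) addnC mulnC; apply: IH; last by rewrite ltn_divLR // mulnC.
rewrite -/(g _) g0 ?ltn_pmod //; by have [] := ideal_gen_ideal (I `|` [set` [:: x]]).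
Qed.

Definition deg_le e p := forall u, u \in msupp p -> (mdeg u <= e)%N.

Lemma deg_leM e1 e2 p q : deg_le e1 p -> deg_le e2 q -> deg_le (e1 + e2) (p * q).
Proof.
move=> p1 q2 u /msuppM_le /allpairsP[[v w] /= [/p1 ve /q2 we ->]].
by rewrite mdegD leq_add.
Qed.

Lemma deg_leW e1 e2 p : (e1 <= e2)%N -> deg_le e1 p -> deg_le e2 p.
Proof. by move=> e12 p1 u /p1 /leq_trans; apply. Qed.

Lemma deg_leX e p k : deg_le e p -> deg_le (k * e) (p ^+ k).
Proof.
move=> pe; elim: k => [|k IH]; last by rewrite exprS mulSn; exact: deg_leM.
by move=> u; rewrite expr0 -mpolyX0 msuppX inE => /eqP ->; rewrite mdeg0.
Qed.

Lemma deg_le_digit_comb e N s c : (forall x, x \in s -> deg_le e x) ->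
  deg_le (size s * (N * e)) (digit_comb N s c).
Proof.
elim: s c => [|x s IH] c se /=.
  move=> u; rewrite msuppC; case: ifP => // _; rewrite inE => /eqP ->.
  by rewrite mdeg0.
have {}IH c' : deg_le (size s * (N * e)) (digit_comb N s c').
  by apply: IH => y ys; apply: se; rewrite inE ys orbT.
move=> u /msupp_sum_le /flattenP[l /mapP[k _ ->]].
apply: (@deg_leW (k * e + size s * (N * e))).
  by rewrite mulSn leq_add2r leq_mul2r ltnW ?orbT.
by apply: deg_leM => //; apply: deg_leX; apply: se; rewrite inE eqxx.
Qed.

Lemma deg_leP s : exists e, forall x, x \in s -> deg_le e x.
Proof.
elim: s => [|x s [e IH]]; first by exists 0%N.
exists (maxn e (msize x)) => y; rewrite inE => /orP[/eqP ->|/IH].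
  by move=> u /msize_mdeg_lt; lia.
by apply: deg_leW; exact: leq_maxl.
Qed.

(** Otherwise there are more combinations [digit_comb N s (delta i)] than monomials available to
    them, and a nonzero vector in the left kernel of their coefficient matrix contradicts
    [digit_comb_indep]. *)
Lemma digit_comb_dim I s e N : is_ideal I -> regular_seq I s ->
  (forall x, x \in s -> deg_le e x) ->
  (N ^ size s <= (size s * (N * e)).+1 ^ n)%N.
Proof.
move=> II reg se; set m := (N ^ size s)%N; set D := _.+1.
rewrite leqNgt; apply/negP => Dm.
pose U := {ffun 'I_n -> 'I_D}.
pose mon (j : 'I_#|{: U}|) : 'X_{1..n} := [multinom (enum_val j l : nat) | l < n].
pose delta (i : 'I_m) (k : nat) : K := (k == i)%:R.
pose B := \matrix_(i < m, j < #|{: U}|) (digit_comb N s (delta i))@_(mon j).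
have kerN0 : kermx B != 0.
  rewrite -mxrank_eq0 mxrank_ker subn_eq0 -ltnNge.
  apply: leq_ltn_trans (rank_leq_col _) _.
  by rewrite card_ffun !card_ord.
pose v := nz_row (kermx B).
have vB : v *m B = 0 by apply/sub_kermxP; exact: nz_row_sub.
pose c k := \sum_i v 0 i * delta i k.
have cE (i : 'I_m) : c i = v 0 i.
  rewrite /c (bigD1 i) //= /delta eqxx mulr1 big1 ?addr0 // => j ji.
  by rewrite eq_sym (inj_eq val_inj) (negbTE ji) mulr0.
have comb0 : digit_comb N s c = 0.
  apply/mpolyP => u; rewrite mcoeff0.
  have [uD|] := leqP (mdeg u) (size s * (N * e))%N; last first.
    move=> uD; apply: memN_msupp_eq0; apply/negP => /(deg_le_digit_comb se).
    by rewrite leqNgt uD.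
  have uD' l : (u l < D)%N.
    by rewrite ltnS; apply: leq_trans uD; rewrite mdegE (bigD1 l) //= leq_addr.
  have -> : u = mon (enum_rank [ffun l => Ordinal (uD' l)]).
    by apply/mnmP => l; rewrite mnmE enum_rankK ffunE.
  move: (enum_rank _) => j.
  have := congr1 (fun A : 'rV_ _ => A 0 j) vB; rewrite !mxE => <-.
  rewrite digit_comb_sum raddf_sum; apply: eq_bigr => i _ /=.
  by rewrite mcoeffZ mxE.
have v0 : v = 0.
  apply/rowP => i; rewrite mxE -cE; apply: (@digit_comb_indep N s I c II reg) => //.
  by rewrite comb0; case: II.
by move/eqP: v0; rewrite nz_row_eq0 (negbTE kerN0).
Qed.

Lemma regular_seq_size I s : is_ideal I -> regular_seq I s -> (size s <= n)%N.
Proof.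
move=> II reg; rewrite leqNgt; apply/negP => ns.
have [e se] := deg_leP s.
(* The right side of [digit_comb_dim] is at most N^n (size s * e + 1)^n, which is below N^(n+1) as
   soon as [N] exceeds the second factor. *)
pose N := ((size s * e).+1 ^ n).+1.
have := digit_comb_dim N II reg se; apply/negP; rewrite -ltnNge.
have leq_expn a b k : (a <= b)%N -> (a ^ k <= b ^ k)%N.
  by move=> ab; elim: k => // k IH; rewrite !expnS leq_mul.
apply: (@leq_trans (N ^ n.+1)); last by rewrite leq_pexp2l.
apply: (@leq_ltn_trans ((N * (size s * e).+1) ^ n)).
  by apply: leq_expn; rewrite /N; nia.
by rewrite expnMn expnSr ltn_pmul2l ?expn_gt0.
Qed.

End RegularSequenceLength.

Lemma greatestP (A : set nat) b : (exists r, A r) -> (forall r, A r -> (r <= b)%N) ->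
  A (greatest A) /\ forall r, A r -> (r <= greatest A)%N.
Proof.
move=> [r Ar] Ab; pose P := [set t | A t /\ forall k, A k -> (k <= t)%N].
suff : P (greatest A) by [].
apply: xgetPex.
have exA : exists i, `[< A i >] by exists r; apply/asboolP.
have leb i : `[< A i >] -> (i <= b)%N by move/asboolP/Ab.
case: (ex_maxnP exA leb) => i /asboolP Ai imax; exists i; split=> // u /asboolP.
exact: imax.
Qed.

Section Depth.
Context {K : fieldType} {n : nat}.
Implicit Types (M : set 'X_{1..n}) (p f g : {mpoly K[n]}) (u v w : 'X_{1..n}).

Lemma depth_span_mon0 N M : upclosed M -> mon_assoc N M [set: 'I_n]%SET ->
  depth_quot (span_mon M : set {mpoly K[n]}) = 0%N.
Proof.
move=> upM [u [NMu _ Mu]]; have II := @span_mon_ideal K n M upM.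
(* If no greatest length exists, the default is 0 as well; otherwise the first element of a nonempty
   regular sequence would annihilate x^u, which is not in the ideal. *)
rewrite /depth_quot /greatest; case: xgetP => [r _ [[s [<- irr reg]] _]|//].
case: s irr reg => // f s irr /(regular_seq_cons II) [regf _].
case: NMu; apply/(@span_monX K)/regf; rewrite mulrC.
have : irrelevant_ideal f by apply: irr; rewrite inE eqxx.
apply: (ideal_gen_min (colon_ideal 'X_[u] II)) => _ [i _ <-] /=.
by rewrite -mpolyXD; apply/span_monX; rewrite addmC; apply: Mu; rewrite inE.
Qed.

(** Without a monomial as required, every multiple of x^u outside [M] has a further multiple by a
    variable outside [M]. Climbing to a large degree makes some exponent of the cofactor exceed [N],
    which forces membership. *)
Lemma socle_above N M u : upclosed M -> ~ M u -> (forall i, M (u + U_(i) *+ N)%MM) ->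
  mon_assoc N M [set: 'I_n]%SET.
Proof.
move=> upM NMu MuN; apply: contrapT => Nsoc.
have step k : exists2 v, ~ M (u + v)%MM & mdeg v = k.
  elim: k => [|k [v NMv vk]]; first by exists 0%MM; rewrite ?addm0 ?mdeg0.
  apply: contrapT => Nv; apply: Nsoc; exists (u + v)%MM; split=> // i.
    by rewrite inE.
  move=> _; apply: contrapT => NMi; apply: Nv; exists (v + U_(i))%MM.
    by rewrite addmA.
  by rewrite mdegD mdeg1 vk addn1.
have [v NMv vk] := step (\sum_(i < n) N).+1%N; apply: NMv.
have /existsP[i iN] : [exists i, (N < v i)%N].
  apply: contraT; rewrite negb_exists => /forallP vN.
  suff : (mdeg v <= \sum_(i < n) N)%N by rewrite vk ltnn.
  by rewrite mdegE; apply: leq_sum => i _; rewrite leqNgt.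
apply: upclosed_le (MuN i) => //; apply/mnm_lepP => j.
by rewrite !mnmDE leq_add2l mulmnE mnm1E; case: eqP => [<-|//]; rewrite mul1n ltnW.
Qed.

(** Suppose x^u is a term of [g] and x^u x_i^N is outside [M]. In the product, the term x^u x_i must
    cancel against another x^v x_j, and v is again such a term with a larger exponent of x_i. This
    cannot go on forever, so [socle_above] applies. *)
Lemma sum_vars_regular N M g : upclosed M -> truncated N M -> (0 < N)%N ->
  ~ mon_assoc N M [set: 'I_n]%SET ->
  span_mon M (g * \sum_(i < n) 'X_i) -> span_mon M g.
Proof.
move=> upM trM N0 Nsoc Mfg u0 u0g; apply: contrapT => NMu0; apply: Nsoc.
apply: (socle_above upM NMu0) => i; apply: contrapT => NMi.
pose bad u := u \in msupp g /\ ~ M (u + U_(i) *+ N)%MM.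
have bad_step u : bad u -> exists2 v, bad v & v i = (u i).+1.
  move=> [ug NMu]; apply: contrapT => Nbad.
  have NMu1 : ~ M (u + U_(i))%MM.
    by move=> Mu; apply: NMu; rewrite -(prednK N0) mulmS addmA; exact: upM.
  have : (u + U_(i))%MM \notin msupp (g * \sum_(j < n) 'X_j).
    by apply/negP => /Mfg.
  rewrite -mcoeff_eq0 mulr_sumr raddf_sum /= (bigD1 i) //= {1}[(u + _)%MM]addmC mcoeffMX.
  rewrite big1 ?addr0 ?mcoeff_eq0 ?ug // => j ji; apply: memN_msupp_eq0.
  rewrite mem_msuppMX; apply/negP => /andP[/mnm_lepP ju vg].
  apply: Nbad; exists (u + U_(i) - U_(j))%MM; last first.
    by rewrite mnmBE mnmDE !mnm1E eqxx (negbTE ji) subn0 addn1.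
  split=> // Mv; apply: NMu.
  (* Multiplying back by x_j gives the exponent u plus N + 1 times e_i; truncation at [N] absorbs
     the extra unit. *)
  have := upM _ U_(j)%MM Mv; apply: trM => k.
  rewrite !mnmDE mnmBE mulmnE !mnmDE !mnm1E; have := ju k; rewrite mnmDE !mnm1E.
  by case: (i == k) (j == k) => -[]; lia.
have step k : exists2 v, bad v & (k <= v i)%N.
  elim: k => [|k [v /bad_step [w wbad wE] kv]]; first by exists u0.
  by exists w => //; rewrite wE.
have [v [vg _]] := step (msize g); have := msize_mdeg_lt vg.
by rewrite mdegE (bigD1 i) //=; lia.
Qed.

Lemma depth_span_mon_gt0 N M : upclosed M -> truncated N M -> (0 < N)%N -> ~ M 0%MM ->
  ~ mon_assoc N M [set: 'I_n]%SET ->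
  (0 < depth_quot (span_mon M : set {mpoly K[n]}))%N.
Proof.
move=> upM trM N0 NM0 Nsoc; have II := @span_mon_ideal K n M upM.
pose f : {mpoly K[n]} := \sum_(i < n) 'X_i.
have irrf : irrelevant_ideal f.
  apply: ideal_sum; first exact: ideal_gen_ideal.
  by move=> i _; apply: sub_ideal_gen; exists i.
have I0 : ideal_gen (span_mon M `|` [set` [::]]) = (span_mon M : set {mpoly K[n]}).
  rewrite -[RHS](ideal_gen_id II); congr ideal_gen.
  by apply/seteqP; split=> y; [case | left].
have regf : regular_seq (span_mon M) [:: f].
  split; first by case=> // _ g; rewrite /= I0; exact: (sum_vars_regular upM trM N0 Nsoc).
  suff sub : ideal_gen (span_mon M `|` [set` [:: f]]) `<=` var_prime [set: 'I_n]%SET.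
    have [_ N1 _] := @var_prime_prime K n [set: 'I_n]%SET.
    by move=> MT; apply/N1/sub; rewrite MT.
  apply: ideal_gen_min; first exact: var_prime_ideal.
  move=> p [Mp u /Mp Mu|]; last first.
    rewrite /= inE => /eqP ->; apply: (ideal_sum (var_prime_ideal _)).
    by move=> i _; apply/var_primeX; rewrite inE.
  apply/off_varsPn; apply/negP => /forall_inP u0; apply: NM0.
  suff <- : u = 0%MM by [].
  by apply/mnmP => i; rewrite mnm0E; apply/eqP/u0; rewrite inE.
rewrite /depth_quot; set A := [set r | _].
have A1 : A 1%N by exists [:: f]; split=> // g; rewrite inE => /eqP ->.
(* This bound makes [greatest] a true maximum instead of its default 0. *)
have Ale r : A r -> (r <= n)%N by move=> [s [<- _ /(regular_seq_size II)]].
by have [_ /(_ _ A1)] := greatestP (ex_intro _ _ A1) Ale.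
Qed.

End Depth.

(** * Powers of almost square-free Veronese ideals *)

Section VeronesePowers.
Import mathcomp.boot.fintype mathcomp.boot.finset.
Local Open Scope nat_scope.
Local Open Scope set_scope.
Context {n : nat}.
Implicit Types (A B S X Y Z P : {set 'I_n}) (u v w : 'X_{1..n}) (d t : nat).
Implicit Types (f g : 'I_n -> nat).

Definition chi B : 'X_{1..n} := [multinom (i \in B : nat) | i < n].

(* Excluding A models the missing generator; nothing is excluded if #|A| <> d. *)
Definition veronese_gens d A : set 'X_{1..n} :=
  fun u => exists B, [/\ #|B| = d, B <> A & u = chi B].

Lemma exists_set_between X Y k :
  X \subset Y -> #|X| <= k <= #|Y| -> exists Z, [/\ X \subset Z, Z \subset Y & #|Z| = k].
Proof.
move=> XY; elim: k => [|k IH] /andP[Xk kY].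
  by exists X; split=> //; apply/eqP; rewrite -leqn0.
move: Xk; rewrite leq_eqVlt => /orP[/eqP Xk|Xk]; first by exists X.
have [|Z [XZ ZY Zk]] := IH; first by rewrite -ltnS Xk ltnW.
have /set0Pn[y] : Y :\: Z != set0.
  by apply: contraTneq kY => /eqP; rewrite setD_eq0 -leqNgt -Zk; exact: subset_leq_card.
rewrite inE => /andP[yZ yY]; exists (y |: Z); split.
- exact: subset_trans XZ (subsetUr _ _).
- by rewrite subUset sub1set yY.
- by rewrite cardsU1 yZ Zk.
Qed.

Lemma sum_setT f : \sum_(i in setT) f i = \sum_i f i.
Proof. by apply: eq_bigl => i; rewrite inE. Qed.

Lemma exists_sum_below P f k : k <= \sum_(i in P) f i ->
  exists g, (forall i, g i <= f i) /\ \sum_(i in P) g i = k.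
Proof.
elim: {f}_.+1 {-2}f (ltnSn (\sum_(i in P) f i)) => // m IH f fm kf.
have [<-|neq] := eqVneq (\sum_(i in P) f i) k; first by exists f.
have [j jP fj] : exists2 j, j \in P & 0 < f j.
  apply/exists_inP; apply: contraT; rewrite negb_exists_in => /forall_inP f0.
  have f0' : \sum_(i in P) f i = 0.
    by apply: big1 => i /f0; rewrite -eqn0Ngt => /eqP.
  by rewrite f0' leqn0 eq_sym in kf neq; rewrite kf in neq.
have sumE : \sum_(i in P) f i = (\sum_(i in P) (f i - (i == j))).+1.
  rewrite (bigD1 j) //= [in RHS](bigD1 j) //= eqxx -addSn; congr (_ + _); first by lia.
  by apply: eq_bigr => i /andP[_ /negbTE ->]; rewrite subn0.
have kf' : k < \sum_(i in P) f i by rewrite ltn_neqAle eq_sym neq.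
rewrite sumE !ltnS in fm kf'.
have [//|//|g [gf gk]] := IH (fun i => f i - (i == j)).
by exists g; split=> // i; apply: leq_trans (gf i) (leq_subr _ _).
Qed.

Definition tsum P t u := \sum_(i in P) minn (u i) t.

Lemma tsumT A t u : tsum setT t u = tsum A t u + tsum (~: A) t u.
Proof.
rewrite /tsum (bigID (mem A)) /=.
by congr (_ + _); apply: eq_bigl => i; rewrite !inE.
Qed.

Lemma tsum_addU P t u j : tsum P t (u + U_(j))%MM = tsum P t u + ((j \in P) && (u j < t)).
Proof.
have [jP|jP] /= := boolP (j \in P); last first.
  rewrite addn0; apply: eq_bigr => i iP; rewrite mnmDE mnm1E.
  by case: eqP => [ji|_]; [rewrite ji iP in jP | rewrite addn0].
rewrite /tsum (bigD1 j) //= [in RHS](bigD1 j) //= mnmDE mnm1E eqxx.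
rewrite (eq_bigr (fun i => minn (u i) t)); first by lia.
by move=> i /andP[_ ij]; rewrite mnmDE mnm1E eq_sym (negbTE ij) addn0.
Qed.

Lemma sum_chi P B : \sum_(i in P) chi B i = #|P :&: B|.
Proof.
under eq_bigr do rewrite mnmE.
rewrite -sum1_card [RHS]big_mkcond [LHS]big_mkcond /=; apply: eq_bigr => i _.
by rewrite inE; case: (i \in P); case: (i \in B).
Qed.

Lemma chi_le B u : reflect (forall i, i \in B -> 0 < u i) (chi B <= u)%MM.
Proof.
apply: (iffP mnm_lepP) => [Bu i iB|Bu i]; first by have := Bu i; rewrite mnmE iB.
by rewrite mnmE; case: (boolP (i \in B)) => // /Bu.
Qed.

Lemma card_setID_eq A B : #|A| = #|B| -> B <> A -> 0 < #|~: A :&: B|.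
Proof.
move=> AB BA; rewrite card_gt0; apply: contra_notN BA => /eqP E.
apply/eqP; rewrite eqEcard AB leqnn andbT; apply/subsetP => i iB.
by apply: contraT => iA; have := in_set0 i; rewrite -E !inE iA iB.
Qed.

(* Peels one factor off w: B takes all i with w_i = t.+1, so that the exponents left
   are <= t, and leaves at least t units outside A for the t remaining factors. *)
Lemma exists_factor d A t w : \sum_i w i = t.+1 * d -> (forall i, w i <= t.+1) ->
  (#|A| = d -> t.+1 <= \sum_(i in ~: A) w i) ->
  exists B, [/\ #|B| = d, B <> A, (forall i, i \in B -> 0 < w i),
    (forall i, w i = t.+1 -> i \in B) &
    (#|A| = d -> t + #|~: A :&: B| <= \sum_(i in ~: A) w i)].
Proof.
move=> wsum wt wA.
pose S := [set i | 0 < w i]; pose F := [set i | w i == t.+1].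
have FS : F \subset S by apply/subsetP => i; rewrite !inE => /eqP ->.
have Fle P : #|F :&: P| * t.+1 <= \sum_(i in P) w i.
  rewrite -sum_nat_const [leqRHS](bigID (mem F)) /=.
  apply: leq_trans (leq_addr _ _).
  rewrite (eq_bigl (fun i => (i \in P) && (i \in F))); last by move=> i; rewrite inE andbC.
  by apply: leq_sum => i; rewrite !inE => /andP[_ /eqP ->].
have Sge P : \sum_(i in P) w i <= #|S :&: P| * t.+1.
  rewrite -sum_nat_const (bigID (mem S)) /= [X in _ + X]big1 ?addn0; last first.
    by move=> i /andP[_]; rewrite !inE -eqn0Ngt => /eqP.
  rewrite (eq_bigl (fun i => i \in S :&: P)); last by move=> i; rewrite in_setI andbC.
  by apply: leq_sum.
have FSI P : F :&: P \subset S :&: P by apply: setSI.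
have BSF B : F \subset B -> B \subset S ->
    (forall i, i \in B -> 0 < w i) /\ (forall i, w i = t.+1 -> i \in B).
  move=> /subsetP FB /subsetP BS; split=> i; first by move/BS; rewrite inE.
  by move=> wi; apply: FB; rewrite inE wi.
have [Ad|Ad] := eqVneq #|A| d; last first.
  have := Fle setT; have := Sge setT; rewrite !setIT sum_setT wsum mulnC.
  rewrite !leq_pmul2r // => dS Fd.
  have [|B [FB BS Bd]] := @exists_set_between F S d FS; first by rewrite Fd.
  have [? ?] := BSF B FB BS.
  exists B; split=> //; last by move=> Ad'; rewrite Ad' eqxx in Ad.
  by move=> BA; rewrite -BA Bd eqxx in Ad.
have {}wA := wA Ad; move: (wsum); rewrite (bigID (mem A)) /=.
rewrite [X in _ + X = _](eq_bigl (mem (~: A))); last by move=> i; rewrite !inE.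
have := Fle A; have := Fle (~: A); have := Sge A; have := Sge (~: A).
have := subset_leq_card (FSI A); have := subset_leq_card (FSI (~: A)).
move: wA; set a := \sum_(i in A) _; set b := \sum_(i in ~: A) _.
set f1 := #|F :&: A|; set f2 := #|F :&: ~: A|.
set s1 := #|S :&: A|; set s2 := #|S :&: ~: A|.
move=> wA fs2 fs1 bs as_ fb fa ab.
have s1d : s1 <= d by rewrite -Ad subset_leq_card // subsetIr.
(* The number of elements of B off [A], taken as small as possible: one to differ from [A], [f2] for
   the forced elements, and [d - s1] because [A] offers only [s1] usable ones. *)
pose j := maxn (maxn 1 f2) (d - s1).
have s2_gt0 : 0 < s2 by nia.
have ds12 : d <= s1 + s2 by nia.
have f1d : f1 < d by nia.
have f12d : f1 + f2 <= d by nia.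
have tf2 : t + f2 <= b by case: (f2) fb => [|?]; nia.
have tds1 : t + (d - s1) <= b by case: (d - s1) (subnKC s1d) => [|?]; nia.
have [|Z1 [FZ1 Z1S Z1j]] := @exists_set_between (F :&: ~: A) (S :&: ~: A) j (FSI _).
  by rewrite -/f2 -/s2 /j; lia.
have [|Z2 [FZ2 Z2S Z2j]] := @exists_set_between (F :&: A) (S :&: A) (d - j) (FSI _).
  by rewrite -/f1 -/s1 /j; lia.
have Z1A : ~: A :&: (Z1 :|: Z2) = Z1.
  rewrite setIUr (setIidPr (subset_trans Z1S (subsetIr _ _))).
  suff /eqP -> : ~: A :&: Z2 == set0 by rewrite setU0.
  by rewrite setI_eq0 disjoint_sym disjoints_subset setCK (subset_trans Z2S) ?subsetIr.
have Z12 : Z1 :&: Z2 = set0.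
  apply/setP => i; rewrite !inE; apply/negP => /andP[].
  by move=> /(subsetP Z1S) + /(subsetP Z2S); rewrite !inE => /andP[_ /negbTE ->]; rewrite andbF.
have [||BS BF] := BSF (Z1 :|: Z2).
- rewrite -(setID F A) setUC; apply: setUSS => //; by rewrite setDE.
- by rewrite subUset (subset_trans Z1S) ?(subset_trans Z2S) ?subsetIl.
exists (Z1 :|: Z2); split=> //.
- by rewrite cardsU Z12 cards0 Z1j Z2j /j; lia.
- move=> ZA; have := Z1j; rewrite -Z1A ZA setIC setICr cards0 /j; lia.
- by move=> _; rewrite Z1A Z1j /j; lia.
Qed.

(** The three conditions on [w] are the ones that persist, with [t] lowered by one, after dividing
    by the generator supplied by [exists_factor]. *)
Lemma mon_pow_balanced d A t w : \sum_i w i = t * d -> (forall i, w i <= t) ->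
  (#|A| = d -> t <= \sum_(i in ~: A) w i) -> mon_pow (veronese_gens d A) t w.
Proof.
elim: t w => [//|t IH] w wsum wt wA.
have [B [Bd BA Bpos Btop BnA]] := exists_factor wsum wt wA.
exists (chi B); first by exists B.
have Bw : (chi B <= w)%MM by apply/chi_le.
have sumB P : \sum_(i in P) (w - chi B)%MM i + #|P :&: B| = \sum_(i in P) w i.
  rewrite -sum_chi -big_split; apply: eq_bigr => i _ /=.
  by rewrite mnmBE subnK //; exact/mnm_lepP.
split=> //; apply: IH.
- by have := sumB setT; rewrite setTI Bd !sum_setT wsum; lia.
- move=> i; rewrite mnmBE mnmE; have := wt i; have [_|iB] := boolP (i \in B); first lia.
  by rewrite subn0 leq_eqVlt => /orP[/eqP /Btop|//]; rewrite (negbTE iB).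
- by move=> Ad; have := sumB (~: A); have := BnA Ad; lia.
Qed.

(** Necessity: each factor contributes [d] to the whole truncated sum and, being different from x_A,
    at least 1 to the part off [A]. Sufficiency: x^u is divisible by a monomial of degree exactly
    [t * d] to which [mon_pow_balanced] applies. *)
Lemma mon_powE d A t u : 0 < d -> mon_pow (veronese_gens d A) t u <->
  t * d <= tsum setT t u /\ (#|A| = d -> t <= tsum (~: A) t u).
Proof.
move=> d0; split.
  elim: t u => [//|t IH] u /= [_ [B [Bd BA ->]] [Bu /IH[Md MA]]].
  have tsumS P : tsum P t (u - chi B)%MM + #|P :&: B| <= tsum P t.+1 u.
    rewrite -sum_chi -big_split; apply: leq_sum => i _ /=.
    by rewrite mnmBE mnmE; have := mnm_lepP Bu i; rewrite mnmE; case: (i \in B); lia.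
  split; first by have := tsumS setT; rewrite setTI Bd; lia.
  move=> Ad; have := tsumS (~: A); have := MA Ad.
  by have := @card_setID_eq A B; rewrite Ad Bd => /(_ erefl BA); lia.
move=> [ud uA].
suff [w [wu wsum wA]] : exists w : 'X_{1..n}, [/\ (forall i, w i <= minn (u i) t),
    \sum_i w i = t * d & (#|A| = d -> t <= \sum_(i in ~: A) w i)].
  apply: (@upclosed_le _ _ w); first exact: mon_pow_up.
    by apply/mnm_lepP => i; apply: leq_trans (wu i) (geq_minl _ _).
  by apply: mon_pow_balanced => // i; apply: leq_trans (wu i) (geq_minr _ _).
have [Ad|Ad] := eqVneq #|A| d; last first.
  have [g [gu gsum]] := exists_sum_below ud.
  exists [multinom g i | i < n]; split; first by move=> i; rewrite mnmE.
    by rewrite -gsum sum_setT; apply: eq_bigr => i _; rewrite mnmE.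
  by move=> Ad'; rewrite Ad' eqxx in Ad.
have {}uA := uA Ad; rewrite (tsumT A) in ud.
(* The share of the degree placed off [A]: at least [t], and at least what [A] cannot absorb. *)
pose b := maxn t (t * d - tsum A t u).
have tle : t <= t * d by nia.
have [|gA [gAu gAsum]] := @exists_sum_below A (fun i => minn (u i) t) (t * d - b).
  by rewrite -/(tsum A t u) /b; lia.
have [|gC [gCu gCsum]] := @exists_sum_below (~: A) (fun i => minn (u i) t) b.
  by rewrite -/(tsum _ t u) /b; lia.
have wC : \sum_(i in ~: A) (if i \in A then gA i else gC i) = b.
  by rewrite -gCsum; apply: eq_bigr => i; rewrite inE => /negbTE ->.
exists [multinom (if i \in A then gA i else gC i) | i < n]; split.
- by move=> i; rewrite mnmE; case: ifP.
- under eq_bigr do rewrite mnmE; rewrite (bigID (mem A)) /=.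
  rewrite [X in _ + X](eq_bigl (mem (~: A))); last by move=> i; rewrite !inE.
  rewrite wC (eq_bigr gA) ?gAsum; last by move=> i ->.
  by rewrite /b; lia.
- by move=> _; under eq_bigr do rewrite mnmE; rewrite wC /b leq_maxl.
Qed.

Lemma mon_pow_truncated d A t : 0 < d -> truncated t (mon_pow (veronese_gens d A) t).
Proof.
move=> d0 u v uv; rewrite !mon_powE //.
have E P : tsum P t u = tsum P t v by apply: eq_bigr.
by rewrite !E.
Qed.

Lemma mon_pow_not0 d A t : 0 < d -> 0 < t -> ~ mon_pow (veronese_gens d A) t 0%MM.
Proof.
move=> d0 t0 /(mon_powE _ _ _ d0)[+ _].
have -> : tsum setT t 0 = 0; last by rewrite leqn0 muln_eq0; lia.
by apply: big1 => i _; rewrite mnm0E min0n.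
Qed.

(** Multiplying by a variable of [A] leaves the sum off [A] unchanged, so a socle monomial already
    satisfies the second inequality and fails the first. Every variable must then raise the
    truncated sum, so all exponents are at most t - 1, and t d - 1 <= n (t - 1) contradicts the
    bound on [t]. *)
Lemma mon_pow_no_socle d A t : 0 < d <= n -> 0 < t -> t * (n - d) < n.-1 ->
  ~ mon_assoc t (mon_pow (veronese_gens d A) t) setT.
Proof.
move=> /andP[d0 dn] t0 tn [u [NMu _ Mu]].
have {}Mu i : mon_pow (veronese_gens d A) t (u + U_(i))%MM by apply: Mu; rewrite inE.
have uA : #|A| = d -> t <= tsum (~: A) t u.
  move=> Ad; have /card_gt0P[a aA] : 0 < #|A| by rewrite Ad.
  have /(mon_powE _ _ _ d0)[_ /(_ Ad)] := Mu a.
  by rewrite tsum_addU inE aA addn0.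
have ud : tsum setT t u < t * d.
  by rewrite ltnNge; apply/negP => ud; apply: NMu; apply/(mon_powE _ _ _ d0).
have {}Mu i : u i < t /\ t * d <= (tsum setT t u).+1.
  have /(mon_powE _ _ _ d0)[+ _] := Mu i.
  by rewrite tsum_addU in_setT /=; case: (u i < t); lia.
have : tsum setT t u <= n * t.-1.
  rewrite -[n in n * _]card_ord -cardsT -sum_nat_const; apply: leq_sum => i _.
  by have [+ _] := Mu i; lia.
have n0 : 0 < n by lia.
have [_] := Mu (Ordinal n0); nia.
Qed.

(* The condition on S that characterises, for all t with t * (n - d) >= n - 1, the
   associated primes of the t-th power. *)
Definition stable_assoc d A S : Prop :=
  if (#|A| == d) && (~: S \subset A) then #|~: S|.+1 <> d else #|~: S| < d.

Lemma tsum_off S t u : (forall i, i \notin S -> t <= u i) -> tsum (~: S) t u = t * #|~: S|.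
Proof.
move=> uS; rewrite mulnC -sum_nat_const; apply: eq_bigr => i.
by rewrite inE => /uS; lia.
Qed.

(** If [~: S] lies in [A] and has size d - 1, multiplying by a variable of [A] in [S] shows that the
    sum off [A] is already at least t, and the exponents off [S] supply the other t (d - 1). In the
    other case, [d] variables off [S] already give t d, and one of those off [A] settles the second
    inequality. *)
Lemma mon_assoc_stable d A S t : 0 < d ->
  mon_assoc t (mon_pow (veronese_gens d A) t) S -> stable_assoc d A S.
Proof.
move=> d0 [u [NMu uS Mu]]; rewrite /stable_assoc; case: ifP => [|NAS].
  move=> /andP[/eqP Ad SA] cd; apply: NMu; apply/(mon_powE _ _ _ d0).
  have : 0 < #|A :&: S|.
    have := cardsID S A; rewrite setDE (setIidPr SA) Ad -cd; lia.
  case/card_gt0P => a; rewrite inE => /andP[aA aS].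
  have /(mon_powE _ _ _ d0)[_ /(_ Ad)] := Mu a aS.
  rewrite tsum_addU inE aA addn0 => tA; split=> //.
  have tS : tsum (~: S) t u <= tsum A t u.
    rewrite [leqRHS](bigID (mem (~: S))) /=; apply: leq_trans (leq_addr _ _).
    rewrite [leqRHS](eq_bigl (mem (~: S))) // => i /=.
    by rewrite andbC; case: (boolP (i \in ~: S)) => //= /(subsetP SA) ->.
  by rewrite (tsumT A); move: tS; rewrite (tsum_off uS) -cd; nia.
rewrite ltnNge; apply/negP => dS; apply: NMu; apply/(mon_powE _ _ _ d0); split.
  by rewrite (tsumT S) (tsum_off uS); nia.
move=> Ad; move: NAS; rewrite Ad eqxx /= => /negbT /subsetPn[i].
rewrite inE => iS iA; rewrite /tsum (bigD1 i) ?inE //=.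
by have := uS i iS; lia.
Qed.

Lemma stable_mon_assoc d A S t : 1 < d < n -> (#|A| = d -> d.+1 < n) ->
  n.-1 <= t * (n - d) -> stable_assoc d A S -> mon_assoc t (mon_pow (veronese_gens d A) t) S.
Proof.
move=> /andP[d1 dn] An tn; have d0 : 0 < d by lia.
have t1 : 1 < t by case: t tn => [|[|t]]; lia.
have cS : #|S| + #|~: S| = n by rewrite cardsC card_ord.
(* Off [S] the exponent is as large as truncation can see; on [S] it stays below [t], so that every
   variable of [S] raises the truncated sum. *)
pose ext g := [multinom (if i \in S then g i else t) | i < n].
have extN g i : i \notin S -> t <= ext g i by move=> /negbTE iS; rewrite mnmE iS.
have extS g : (forall i, g i <= t.-1) -> tsum S t (ext g) = \sum_(i in S) g i.
  by move=> gt; apply: eq_bigr => i iS; rewrite mnmE iS; have := gt i; lia.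
have extlt g i : (forall i, g i <= t.-1) -> i \in S -> ext g i < t.
  by move=> gt iS; rewrite mnmE iS; have := gt i; lia.
have capE P : \sum_(i in P) t.-1 = #|P| * t.-1 by rewrite sum_nat_const.
rewrite /stable_assoc; case: ifP => [/andP[/eqP Ad SA]|NAS] Sd; last first.
  (* The total t d - 1 is one short of the first inequality. With c the size of [~: S], the capacity
     (n - c) (t - 1) of [S] suffices because n - 1 <= t (n - d). *)
  have [|g [gt gsum]] := @exists_sum_below S (fun=> t.-1) (t * (d - #|~: S|)).-1.
    by rewrite capE; nia.
  have Tg : tsum setT t (ext g) = (t * d).-1.
    by rewrite (tsumT S) (tsum_off (extN g)) extS // gsum; nia.
  exists (ext g); split; [|exact: extN|].
    by move/(mon_powE _ _ _ d0) => [+ _]; rewrite Tg; nia.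
  move=> i iS; apply/(mon_powE _ _ _ d0); rewrite !tsum_addU Tg inE extlt //=.
  split; first by lia.
  move=> Ad; move: NAS; rewrite Ad eqxx /= => /negbT /subsetPn[j].
  rewrite inE => jS jA; apply: leq_trans (leq_addr _ _).
  by rewrite /tsum (bigD1 j) ?inE //=; have := extN g j jS; lia.
have AnS : #|A :&: S| + #|~: S| = d.
  by have := cardsID S A; rewrite setDE (setIidPr SA) Ad.
have cA : #|~: A| + d = n by rewrite addnC -Ad cardsC card_ord.
have AS : ~: A \subset S by rewrite -[S]setCK setCS.
have {}An := An Ad.
(* If [~: S] has size [d] it equals [A]; the first inequality then holds by itself, and the witness
   fails only the second one, by one unit. *)
have [Sd'|Sd'] := eqVneq #|~: S| d.
  have [|g [gt gsum]] := @exists_sum_below (~: A) (fun=> t.-1) t.-1.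
    by rewrite capE; nia.
  have SE : S = ~: A.
    by apply/eqP; rewrite eq_sym eqEcard AS; lia.
  have Ag : tsum (~: A) t (ext g) = t.-1 by rewrite -SE extS // SE.
  exists (ext g); split; [|exact: extN|].
    by move/(mon_powE _ _ _ d0) => [_ /(_ Ad)]; rewrite Ag; lia.
  move=> i iS; apply/(mon_powE _ _ _ d0); rewrite !tsum_addU inE extlt //= -SE iS.
  rewrite (tsumT S) (tsum_off (extN g)) SE Ag; split; last by lia.
  by rewrite -SE Sd'; lia.
(* Now c <= d - 2. The amount [b] off [A] is at least [t] to secure the second inequality, and at
   least d - c - 1, which is what [A :&: S] cannot hold of the total t (d - c) - 1. It fits off [A]
   because d + 1 < n and n - 1 <= t (n - d). *)
pose c := #|~: S|; pose b := maxn t (d - c).-1.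
have [|gC [gCt gCsum]] := @exists_sum_below (~: A) (fun=> t.-1) b.
  by rewrite capE /b geq_max; apply/andP; split; nia.
have [|gA [gAt gAsum]] := @exists_sum_below (A :&: S) (fun=> t.-1) ((t * (d - c)).-1 - b).
  by rewrite capE /b; nia.
pose g i := if i \in A then gA i else gC i.
have gt i : g i <= t.-1 by rewrite /g; case: ifP.
have gsumA : \sum_(i in ~: A) g i = b.
  by rewrite -gCsum; apply: eq_bigr => i; rewrite inE /g => /negbTE ->.
have gsumI : \sum_(i in A :&: S) g i = (t * (d - c)).-1 - b.
  by rewrite -gAsum; apply: eq_bigr => i; rewrite inE /g => /andP[->].
have gsum : \sum_(i in S) g i = (t * (d - c)).-1.
  transitivity (\sum_(i in A :&: S) g i + \sum_(i in ~: A) g i).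
    rewrite (bigID (mem A)) /=; congr (_ + _); apply: eq_bigl => i; rewrite !inE andbC //.
    by case: (boolP (i \in A)) => //= iA; apply: (subsetP AS); rewrite inE.
  by rewrite gsumI gsumA /b; nia.
have Tg : tsum setT t (ext g) = (t * d).-1.
  by rewrite (tsumT S) (tsum_off (extN g)) extS // gsum -/c; nia.
exists (ext g); split; [|exact: extN|].
  by move/(mon_powE _ _ _ d0) => [+ _]; rewrite Tg; nia.
move=> i iS; apply/(mon_powE _ _ _ d0); rewrite !tsum_addU Tg inE extlt //=.
split; first by lia.
move=> _; apply: leq_trans (leq_addr _ _).
apply: (@leq_trans b); first by rewrite /b leq_maxl.
rewrite -gsumA; apply: leq_sum => j jA; rewrite mnmE (subsetP AS) //.
by have := gt j; lia.
Qed.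

End VeronesePowers.

(** * Minimal generators *)

Section MinimalGenerators.
Local Open Scope fset_scope.
Context {K : fieldType} {n : nat}.
Implicit Types (J : set {mpoly K[n]}) (A B : {set 'I_n}) (d : nat).
Implicit Types (G : {fset 'X_{1..n}}) (M : set 'X_{1..n}) (u v m : 'X_{1..n}).

Lemma mem_monomials_ideal M u : (monomials_ideal M : set {mpoly K[n]}) 'X_[u] <->
  exists2 m, M m & (m <= u)%MM.
Proof. by rewrite monomials_idealE; exact: span_monX. Qed.

Lemma lepm_mdeg u v : (u <= v)%MM -> (mdeg u <= mdeg v)%N.
Proof. by move=> /submK <-; rewrite mdegD leq_addl. Qed.

Lemma lepm_eq u v : (u <= v)%MM -> mdeg u = mdeg v -> u = v.
Proof.
move=> uv duv; rewrite -[RHS](submK uv).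
suff /eqP -> : (v - u == 0)%MM by rewrite add0m.
by rewrite -mdeg_eq0 -(eqn_add2r (mdeg u)) -mdegD submK // duv.
Qed.

Lemma mdeg_chi B : mdeg (chi B) = #|B|.
Proof.
rewrite mdegE; under eq_bigr do rewrite mnmE.
by rewrite -sum1_card [RHS]big_mkcond; apply: eq_bigr => i _; case: (i \in B).
Qed.

Lemma sqfree_chi (u : 'X_{1..n}) : sqfree_mon u -> u = chi [set i | (0 < u i)%N]%SET.
Proof.
by move=> u1; apply/mnmP => i; rewrite mnmE inE; case: (u i) (u1 i) => [|[]].
Qed.

Lemma chi_inj : injective (chi : {set 'I_n} -> _).
Proof.
move=> A B AB; apply/setP => i; have := congr1 (fun u : 'X_{1..n} => u i) AB.
by rewrite !mnmE; case: (i \in A) (i \in B) => -[].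
Qed.

(* In a common degree there is no divisibility, so generators are minimal. *)
Lemma equigenerated_min_gens J G d : (forall m, m \in G -> mdeg m = d) ->
  J = monomials_ideal [set` G] -> min_gens J = G.
Proof.
move=> Gd JG; have sub G' : J = monomials_ideal [set` G'] -> {subset G <= G'}.
  move=> JG' m mG.
  have : J 'X_[m] by rewrite JG; apply/mem_monomials_ideal; exists m => //; exact: lepm_refl.
  rewrite JG' => /mem_monomials_ideal[m' m'G' m'm].
  have : J 'X_[m'] by rewrite JG'; apply/mem_monomials_ideal; exists m' => //; exact: lepm_refl.
  rewrite JG => /mem_monomials_ideal[m0 /= m0G m0m'].
  suff <- : m' = m by [].
  apply: lepm_eq => //; apply/eqP; rewrite eqn_leq lepm_mdeg //=.
  by rewrite (Gd m mG) -(Gd m0 m0G) lepm_mdeg.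
have sub_eq G1 G2 : {subset G1 <= G2} -> {subset G2 <= G1} -> G1 = G2.
  by move=> s12 s21; apply/fsetP => m; apply/idP/idP; [exact: s12 | exact: s21].
have GJ : is_min_gens J G by split=> // G' G'G JG'; apply: sub_eq => //; exact: sub.
apply: xget_unique => // G' [JG' G'min].
by symmetry; apply: G'min => //; exact: sub.
Qed.

(** A value other than the default [fset0] satisfies its specification, which sidesteps Dickson's
    lemma. *)
Lemma min_gens_neq0 J : min_gens J != fset0 -> J = monomials_ideal [set` min_gens J].
Proof. by rewrite /min_gens; case: xgetP => [G _ []|_] //; rewrite eqxx. Qed.

Definition veronese_fset d : {fset 'X_{1..n}} :=
  [fset m | m in [seq chi B | B <- enum [pred B : {set 'I_n} | #|B| == d]]].

Lemma veronese_fsetP d m :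
  reflect (exists2 B : {set 'I_n}, #|B| = d & m = chi B) (m \in veronese_fset d).
Proof.
rewrite in_fset /=; apply: (iffP mapP) => -[B + ->].
  by rewrite mem_enum => /eqP; exists B.
by move=> Bd; exists B => //; rewrite mem_enum inE Bd.
Qed.

Lemma min_gens_sqfree_veronese d :
  min_gens (sqfree_veronese d : set {mpoly K[n]}) = veronese_fset d.
Proof.
apply: (@equigenerated_min_gens _ _ d).
  by move=> m /veronese_fsetP[B <- ->]; exact: mdeg_chi.
congr monomials_ideal; apply/seteqP; split=> m /=.
  move=> [/sqfree_chi mE md]; apply/veronese_fsetP; exists [set i | (0 < m i)%N]%SET => //.
  by rewrite -md {2}mE mdeg_chi.
move=> /veronese_fsetP[B <- ->]; split; last exact: mdeg_chi.
by move=> i; rewrite mnmE leq_b1.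
Qed.

(** With at least one variable, full support provides a generator. For n = 0 the only monomial is 1,
    and a nonzero J is the unit ideal, generated by it. *)
Lemma almost_veronese_neq0 d J : (2 <= d)%N -> almost_sqfree_veronese d J ->
  full_supported J -> min_gens J != fset0.
Proof.
move=> d2 [[M JM] J0 sub _] supp; apply/eqP => G0.
case: (posnP n) => [n0|n0]; last first.
  by have [m] := supp (Ordinal n0); rewrite G0 inE.
have u0 (u : 'X_{1..n}) : u = 0%MM.
  by apply/mnmP => -[i i_lt]; exfalso; move: i_lt; rewrite n0.
have M0 : M 0%MM.
  apply: contrapT => NM; apply: J0; rewrite JM monomials_idealE.
  apply/seteqP; split=> [p pM|_ -> u]; last by rewrite msupp0.
  apply: contrapT => /eqP /neq0_msupp[u /pM [m]].
  by rewrite (u0 m).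
have JG : J = monomials_ideal [set` [fset (0%MM : 'X_{1..n})]].
  rewrite JM; congr monomials_ideal; apply/seteqP; split=> u /=.
    by rewrite (u0 u) inE.
  by rewrite (u0 u).
have := equigenerated_min_gens (d := 0) _ JG; rewrite G0 => G1.
have : 0%MM \in (fset0 : {fset 'X_{1..n}}).
  by rewrite G1 ?inE // => m _; rewrite (u0 m) mdeg0.
by rewrite inE.
Qed.

Lemma almost_veroneseE d J : (2 <= d)%N ->
  almost_sqfree_veronese d J -> full_supported J -> has_gcd1 J ->
  (d < n)%N /\ exists A, (#|A| = d -> (d.+1 < n)%N) /\
    J = monomials_ideal (veronese_gens d A).
Proof.
move=> d2 JV supp [_ gcd1]; have Gn0 := almost_veronese_neq0 d2 JV supp.
have JG := min_gens_neq0 Gn0; case: JV => _ _; rewrite min_gens_sqfree_veronese.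
move: (min_gens J) Gn0 JG gcd1 => G Gn0 JG gcd1 GV Gcard.
have [A GA] : exists A, forall m, m \in G <-> veronese_gens d A m.
  have [D0|/fset0Pn[a]] := eqVneq (veronese_fset d `\` G) fset0.
    (* No generator is missing; the empty set does not have size [d], so excluding it changes
       nothing. *)
    exists finset.set0 => m; split.
      move=> /GV/veronese_fsetP[B Bd ->]; exists B; split=> // B0.
      by move: Bd; rewrite B0 cards0; lia.
    move=> [B [Bd _ mB]]; apply: contraT => mG.
    have : m \in (fset0 : {fset 'X_{1..n}}); last by rewrite inE.
    by rewrite -D0 inE mG; apply/veronese_fsetP; exists B.
  rewrite inE => /andP[aG /veronese_fsetP[A Ad aE]]; exists A => m; split.
    move=> mG; have /veronese_fsetP[B Bd mB] := GV _ mG; exists B; split=> // BA.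
    by move: aG; rewrite aE -BA -mB mG.
  move=> [B [Bd BA mB]]; apply: contraT => mG.
  have aGsub : a |` (m |` G) `<=` veronese_fset d.
    apply/fsubsetP => z; rewrite !in_fset1U => /orP[/eqP ->|/orP[/eqP ->|/GV //]].
      by apply/veronese_fsetP; exists A.
    by apply/veronese_fsetP; exists B.
  (* Two distinct missing generators would violate the lower bound on the number of generators. *)
  have := fsubset_leq_card aGsub; rewrite !cardfsU1 in_fset1U (negbTE aG) mG orbF.
  have -> : a != m by apply/eqP => am; apply: BA; apply: chi_inj; rewrite -mB -am.
  by move=> ?; lia.
have [m mG] : exists m, m \in G by apply/fset0Pn.
have /GA [B [Bd BA mB]] := mG.
have Bn : (d <= n)%N by rewrite -Bd -[leqRHS]card_ord max_card.
have n0 : (0 < n)%N by lia.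
have NU i : ~ (forall m', m' \in G -> (0 < m' i)%N).
  move=> Gi; have /mnm_lepP/(_ i) : (U_(i) <= 0)%MM.
    by apply: gcd1 => m' /Gi; rewrite lep1mP lt0n.
  by rewrite mnm1E eqxx mnm0E.
have dn : (d < n)%N.
  rewrite ltn_neqAle Bn andbT; apply/eqP => dn.
  apply: (NU (Ordinal n0)) => m' /GA [B' [B'd _ ->]].
  have /eqP -> : B' == [set: 'I_n]%SET by rewrite eqEcard finset.subsetT cardsT card_ord B'd dn /=.
  by rewrite mnmE inE.
split=> //; exists A; split; last by rewrite JG; congr monomials_ideal; apply/seteqP; split=> z /GA.
(* If d + 1 = n, the only set of size [d] that omits a variable x off [A] is [A] itself, so x would
   divide every remaining generator. *)
move=> Ad; rewrite ltn_neqAle dn andbT; apply/eqP => d1n.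
have /card_gt0P[x] : (0 < #|~: A|%SET)%N by have := cardsC A; rewrite card_ord Ad; lia.
rewrite inE => xA; apply: (NU x) => m' /GA [B' [B'd B'A ->]].
rewrite mnmE lt0b; apply: contraT => xB'; case: B'A.
have cx : #|~: [set x]|%SET = d by have := cardsC [set x]; rewrite cards1 card_ord; lia.
have sub_eq (C : {set 'I_n}) : #|C| = d -> x \notin C -> C = (~: [set x])%SET.
  move=> Cd xC; apply/eqP; rewrite eqEcard cx Cd leqnn andbT.
  by apply/fintype.subsetP => y yC; rewrite !inE; apply: contraNneq xC => <-.
by rewrite (sub_eq B') // (sub_eq A).
Qed.

End MinimalGenerators.

(** * The stability indices *)

Lemma least_unique (A : set nat) t0 : A t0 -> (forall u, A u -> (t0 <= u)%N) ->
  least A = t0.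
Proof.
move=> At0 t0min; apply: xget_unique => // t [At tmin].
by apply/eqP; rewrite eqn_leq t0min // tmin.
Qed.

Section StabilityIndices.
Context {K : fieldType} {n : nat}.
Variables (d t0 : nat) (A : {set 'I_n}).
Hypotheses (dn : (1 < d < n)%N) (An : #|A| = d -> (d.+1 < n)%N).
Hypotheses (t0_ge : (n.-1 <= t0 * (n - d))%N).
Hypotheses (t0_min : forall t, (t < t0)%N -> (t * (n - d) < n.-1)%N).

Let J : set {mpoly K[n]} := monomials_ideal (veronese_gens d A).

Let d_gt0 : (0 < d)%N. Proof. by lia. Qed.

Let t0_gt0 : (0 < t0)%N. Proof. by case: t0 t0_ge => // ; lia. Qed.

Let ge_t0 t : (t0 <= t)%N -> (n.-1 <= t * (n - d))%N.
Proof. by move=> /(leq_mul (leqnn (n - d))); rewrite !(mulnC (n - d)%N); exact: leq_trans. Qed.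

Let stable_assocT : stable_assoc d A [set: 'I_n]%SET.
Proof. by rewrite /stable_assoc finset.setCT cards0; case: ifP => _; lia. Qed.

Let no_socle t : (0 < t < t0)%N ->
  ~ mon_assoc t (mon_pow (veronese_gens d A) t) [set: 'I_n]%SET.
Proof. by move=> /andP[t1 /t0_min]; apply: mon_pow_no_socle => //; lia. Qed.

Lemma Ass_pow t : (0 < t)%N -> Ass (ideal_pow J t) = [set P | exists2 S,
  mon_assoc t (mon_pow (veronese_gens d A) t) S & P = var_prime S].
Proof.
move=> t1; rewrite ideal_pow_monomials (@Ass_span_mon _ _ t) //; first exact: mon_pow_up.
exact: mon_pow_truncated.
Qed.

Lemma Ass_pow_stable t : (t0 <= t)%N ->
  Ass (ideal_pow J t) = [set P | exists2 S, stable_assoc d A S & P = var_prime S].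
Proof.
move=> t0t; rewrite Ass_pow; last exact: leq_trans t0t.
apply/seteqP; split=> P [S SA ->]; exists S => //; first exact: mon_assoc_stable SA.
by apply: stable_mon_assoc => //; exact: ge_t0.
Qed.

Lemma astab_eq : astab J = t0.
Proof.
apply: least_unique => [|u [u1 uA]].
  by split=> // t t0t; rewrite !Ass_pow_stable.
rewrite leqNgt; apply/negP => ut0.
have : Ass (ideal_pow J t0) (var_prime [set: 'I_n]%SET).
  by rewrite Ass_pow_stable //; exists [set: 'I_n]%SET.
rewrite uA; last exact: ltnW.
rewrite Ass_pow // => -[S + /var_prime_inj ST]; rewrite -ST.
by apply: no_socle; rewrite u1.
Qed.

Lemma dstab_eq : dstab J = t0.
Proof.
have depth0 t : (t0 <= t)%N -> depth_quot (ideal_pow J t) = 0%N.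
  move=> t0t; rewrite ideal_pow_monomials; apply: (@depth_span_mon0 _ _ t).
    exact: mon_pow_up.
  by apply: stable_mon_assoc => //; exact: ge_t0.
apply: least_unique => [|u [u1 uA]].
  by split=> // t t0t; rewrite !depth0.
rewrite leqNgt; apply/negP => ut0; have := uA t0 (ltnW ut0).
rewrite depth0 // => /esym/eqP; apply/negP; rewrite -lt0n ideal_pow_monomials.
apply: (@depth_span_mon_gt0 _ _ u) => //; first exact: mon_pow_up.
- exact: mon_pow_truncated.
- exact: mon_pow_not0.
- by apply: no_socle; rewrite u1.
Qed.

End StabilityIndices.

Theorem theorem2p16 (K : fieldType) (n d : nat) (J : set {mpoly K[n]})
    (hd : (2 <= d)%N)
    (hJ : almost_sqfree_veronese d J)
    (hsupp : full_supported J)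
    (hgcd : has_gcd1 J) :
  astab J = dstab J /\
  (dstab J)%:Z = Num.ceil ((n%:R - 1) / (n%:R - d%:R) : rat).
Proof.
have [dn [A [An ->]]] := almost_veroneseE hd hJ hsupp hgcd.
(* Adding n - d - 1 before the Euclidean division rounds the quotient up. *)
pose t0 := ((n.-1 + (n - d).-1) %/ (n - d))%N.
have q0 : (0 < n - d)%N by lia.
have dn' : (1 < d < n)%N by rewrite hd.
have := divn_eq (n.-1 + (n - d).-1) (n - d); rewrite -/t0.
have := ltn_pmod (n.-1 + (n - d).-1) q0.
move: (_ %% _)%N => r rq t0E.
have t0_ge : (n.-1 <= t0 * (n - d))%N by lia.
have t0_lt : (t0.-1 * (n - d) < n.-1)%N by nia.
have t0_min t : (t < t0)%N -> (t * (n - d) < n.-1)%N by nia.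
rewrite (astab_eq dn' An t0_ge t0_min) (dstab_eq dn' An t0_ge t0_min); split=> //.
have t0_gt0 : (0 < t0)%N by nia.
apply/esym/Num.Theory.ceil_def.
have -> : (t0%:Z - 1)%:~R = (t0.-1)%:R :> rat.
  by rewrite -[in LHS](prednK t0_gt0) intS addrC addKr.
have -> : n%:R - 1 = n.-1%:R :> rat by rewrite -subn1 natrB //; lia.
rewrite -natrB ?(ltnW dn) //.
rewrite Num.Theory.ltr_pdivlMr ?Num.Theory.ltr0n //.
rewrite Num.Theory.ler_pdivrMr ?Num.Theory.ltr0n //.
by rewrite -!natrM Num.Theory.ltr_nat Num.Theory.ler_nat t0_lt t0_ge.
Qed.
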